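(* The polynomials $I_n(x)=\sum_{k=0}^{n-1}i_{n,k}x^k$ are in general not log-concave: there exists a positive integer $n$ such that the coefficient sequence $(i_{n,k})_{k}$ satisfies $i_{n,k-1}\,i_{n,k+1}>i_{n,k}^2$ for some $k$.
   Context: For a positive integer $n$, $i_{n,k}$ denotes the number of involutions $\sigma$ of $\{1,\dots,n\}$ with exactly $k$ descents, where a descent of $\sigma$ is an index $1\le i<n$ with $\sigma(i)>\sigma(i+1)$. A sequence $(s_i)$ is log-concave if $s_{i-1}s_{i+1}\le s_i^2$ for every $i>0$. *)

(* Defs.v *)
From HB Require Import structures.
From mathcomp Require Import all_boot all_order all_fingroup all_algebra.

Set Implicit Arguments.
Unset Strict Implicit.
Unset Printing Implicit Defensive.

(* {1, .., n} is represented by 'I_n = {0, .., n-1}; i is a descent of s when it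
   has a successor j in 'I_n and s j < s i. *)
Definition descents (n : nat) (s : 'S_n) : {set 'I_n} :=
  [set i : 'I_n | [exists j : 'I_n, (val j == (val i).+1) && (s j < s i)]].

(* The identity counts as an involution. *)
Definition involutions (n : nat) : {set 'S_n} :=
  [set s : 'S_n | [forall i, s (s i) == i]].

Definition inv_des (n k : nat) : nat :=
  #|[set s in involutions n | #|descents s| == k]|.

Definition inv_des_poly (n : nat) : {poly int} :=
  (\sum_(k < n) (inv_des n k)%:R *: 'X^k)%R.

Definition log_concave (R : numDomainType) (s : nat -> R) : Prop :=
  forall i, 0 < i -> (s i.-1 * s i.+1 <= s i ^+ 2)%R.

(* Main.v *)
Require Import Defs.
From HB Require Import structures.
From mathcomp Require Import all_boot all_order all_fingroup all_algebra.
From mathcomp Require Import zify.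

(** Log-concavity already fails at [k = 1] for large [n], because [i_{n,0}] is
    positive, [i_{n,1}] is at most quadratic in [n] and [i_{n,2}] grows like
    [n^5].

    An involution whose only descent is [d] exchanges two adjacent blocks of
    equal length by translation and fixes everything else, so it is determined
    by [d] and its value at [d].

    For the lower bound, cut the positions into nine consecutive intervals
    [P11, P12, P13, P21, .., P33] with [|Pij| = |Pji|], and let the involution
    translate [Pij] onto [Pji].  It increases on each of the three rows
    [Pi1, Pi2, Pi3], and drops exactly at the two row boundaries when the
    off-diagonal intervals are nonempty.  Five of the six sizes are free. *)

Set Implicit Arguments.
Unset Strict Implicit.
Unset Printing Implicit Defensive.

(** * Permutations as functions on natural numbers *)

Section PermAsNatFunction.

Variable n : nat.
Implicit Type s : 'S_n.

(** Values in [nat] allow [i.+1] and [lia] without bound proofs; out of range the default is [i]. *)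
Definition nat_of_perm s (i : nat) : nat :=
  if insub i is Some j then val (s j) else i.

Lemma nat_of_permE s (i : 'I_n) : nat_of_perm s i = s i.
Proof. by rewrite /nat_of_perm valK. Qed.

Lemma nat_of_perm_lt s i : i < n -> nat_of_perm s i < n.
Proof. by move=> lt_in; rewrite (nat_of_permE s (Ordinal lt_in)) ltn_ord. Qed.

Lemma nat_of_perm_inj s i j :
  i < n -> j < n -> nat_of_perm s i = nat_of_perm s j -> i = j.
Proof.
move=> lt_in lt_jn.
rewrite (nat_of_permE s (Ordinal lt_in)) (nat_of_permE s (Ordinal lt_jn)).
by move/val_inj/perm_inj/(congr1 val).
Qed.

Lemma nat_of_perm_involutive s i :
  s \in involutions n -> i < n -> nat_of_perm s (nat_of_perm s i) = i.
Proof.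
rewrite inE => /forallP inv_s lt_in.
rewrite (nat_of_permE s (Ordinal lt_in)) nat_of_permE.
by rewrite (eqP (inv_s (Ordinal lt_in))).
Qed.

Lemma mem_descents s (i : 'I_n) :
  (i \in descents s)
    = (i.+1 < n) && (nat_of_perm s i.+1 < nat_of_perm s i).
Proof.
rewrite inE; apply/existsP/andP => [[j /andP[/eqP ij lt_s]] | [lt_in lt_s]].
  by split; rewrite -[i.+1]ij ?ltn_ord ?nat_of_permE.
exists (Ordinal lt_in); rewrite eqxx /=.
by move: lt_s; rewrite (nat_of_permE s (Ordinal lt_in)) nat_of_permE.
Qed.

End PermAsNatFunction.

(** * Rigidity of involutions with one descent *)

Section OneDescent.

Variables (n d : nat).
Hypothesis lt_dn : d < n.

Definition increasing_off_d (f : nat -> nat) :=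
  forall i, i.+1 < n -> i != d -> f i < f i.+1.

Definition involution_below (f : nat -> nat) :=
  forall i, i < n -> f i < n /\ f (f i) = i.

Section OneFunction.

Variable f : nat -> nat.
Hypotheses (incr_f : increasing_off_d f) (inv_f : involution_below f).

Lemma increasing_below_d i j : i < j -> j <= d -> f i < f j.
Proof.
elim: j => // j IHj; rewrite ltnS leq_eqVlt => /predU1P[-> | lt_ij] le_jd.
  by apply: incr_f; lia.
by apply: (ltn_trans (IHj lt_ij (ltnW le_jd))); apply: incr_f; lia.
Qed.

Lemma increasing_above_d i j : d < i -> i < j -> j < n -> f i < f j.
Proof.
move=> lt_di; elim: j => // j IHj.
rewrite ltnS leq_eqVlt => /predU1P[<- | lt_ij] lt_jn.
  by apply: incr_f; lia.
by apply: (ltn_trans (IHj lt_ij (ltnW lt_jn))); apply: incr_f; lia.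
Qed.

Lemma leq_f_below_d i : i <= d -> i <= f i.
Proof.
elim: i => // i IHi lt_id; apply: leq_ltn_trans (IHi (ltnW lt_id)) _.
exact: increasing_below_d.
Qed.

Lemma geq_f_above_d i : d < i -> i < n -> f i <= i.
Proof.
(* Strict growth from [i] to the last position must leave room below [n]. *)
move=> lt_di lt_in; have: f i + (n.-1 - i) <= n.-1; last by lia.
have bound k : i + k < n -> f i + k <= f (i + k).
  elim: k => [|k IHk] lt_ik; first by rewrite !addn0.
  have := increasing_above_d (i := i + k) (j := i + k.+1).
  by have := IHk; lia.
have := bound (n.-1 - i); have [] := inv_f (i := i + (n.-1 - i)); first by lia.
by lia.
Qed.

(** Both [i] and [f i] lie where [f] dominates the identity, so [i <= f i <= f (f i) = i]. *)
Lemma fixed_below_d i : i <= d -> f i <= d -> f i = i.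
Proof.
move=> le_id le_fd; have [_ ffi] := inv_f (leq_ltn_trans le_id lt_dn).
by have := leq_f_below_d le_id; have := leq_f_below_d le_fd; lia.
Qed.

Lemma fixed_above_d i : d < i -> i < n -> d < f i -> f i = i.
Proof.
move=> lt_di lt_in lt_df; have [lt_fn ffi] := inv_f lt_in.
by have := geq_f_above_d lt_di lt_in; have := geq_f_above_d lt_df lt_fn; lia.
Qed.

Lemma succ_below_d i : i < d -> d < f i -> f i.+1 = (f i).+1.
Proof.
move=> lt_id lt_df.
have lt_f := increasing_below_d (ltnSn i) lt_id.
have [lt_fn ffi] := inv_f (ltn_trans lt_id lt_dn).
have [lt_fSn ffSi] := inv_f (leq_ltn_trans lt_id lt_dn).
apply/eqP; rewrite eqn_leq lt_f andbT leqNgt; apply/negP => gap.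
(* The value just above [f i] would be sent strictly between [i] and [i.+1]. *)
have := increasing_above_d lt_df (ltnSn _) (ltn_trans gap lt_fSn).
have := increasing_above_d (leqW lt_df) gap lt_fSn.
by lia.
Qed.

End OneFunction.

(** Otherwise [g i <= d]. As [g] sends [(f i).+1] to [i.+1] and increases above [d], [g (f i) <= i];
    applying [g] gives [f i <= g i <= d], a contradiction. *)
Lemma jump_of_eq_succ f g i :
    increasing_off_d f -> involution_below f ->
    increasing_off_d g -> involution_below g ->
  i < d -> f i.+1 = g i.+1 -> d < f i -> d < g i.
Proof.
move=> incr_f inv_f incr_g inv_g lt_id eqS lt_df.
rewrite ltnNge; apply/negP => le_gd.
have eq_fS := succ_below_d incr_f inv_f lt_id lt_df.
have [lt_fn _] := inv_f _ (ltn_trans lt_id lt_dn).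
have [lt_gSn ggSi] := inv_g _ (leq_ltn_trans lt_id lt_dn).
have := increasing_above_d incr_g lt_df (ltnSn (f i)).
rewrite -eq_fS eqS ggSi => /(_ lt_gSn) le_gfi.
have [_ ggf] := inv_g _ lt_fn.
case: (ltngtP (g (f i)) i) => [lt_gi | | eq_gi]; [|lia|].
  by have := increasing_below_d incr_g lt_gi (ltnW lt_id); lia.
by move: ggf; rewrite eq_gi; lia.
Qed.

Lemma one_descent_involution_eq f g :
    increasing_off_d f -> involution_below f ->
    increasing_off_d g -> involution_below g ->
  f d = g d -> forall i, i < n -> f i = g i.
Proof.
move=> incr_f inv_f incr_g inv_g eq_d.
(* Induction downwards from [d]: at each position both functions jump past [d], with value one less
   than at the successor, or both fix the position. *)
have below k : k <= d -> f (d - k) = g (d - k).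
  elim: k => [|k IHk] lt_kd; first by rewrite subn0.
  set i := d - k.+1; have lt_id : i < d by lia.
  have eqS : f i.+1 = g i.+1.
    by rewrite (_ : i.+1 = d - k); [apply: IHk; lia | lia].
  have [lt_df | le_fd] := ltnP d (f i).
    have lt_dg : d < g i by exact: (jump_of_eq_succ incr_f).
    have := succ_below_d incr_f inv_f lt_id lt_df.
    by have := succ_below_d incr_g inv_g lt_id lt_dg; lia.
  have [lt_dg | le_gd] := ltnP d (g i).
    by have := jump_of_eq_succ incr_g inv_g incr_f inv_f lt_id (esym eqS) lt_dg; lia.
  have := fixed_below_d incr_f inv_f (ltnW lt_id) le_fd.
  by have := fixed_below_d incr_g inv_g (ltnW lt_id) le_gd; lia.
have {}below i : i <= d -> f i = g i.
  by move=> le_id; rewrite -(subKn le_id) below // leq_subr.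
move=> i lt_in; case: (leqP i d) => [/below // | lt_di].
have [lt_fn ffi] := inv_f _ lt_in; have [lt_gn ggi] := inv_g _ lt_in.
(* A value at most [d] lies where [f] and [g] already agree, so [g (f i) = f (f i) = i]; otherwise
   position [i] is fixed. *)
have [lt_df | le_fd] := ltnP d (f i); last first.
  by have [_] := inv_g _ lt_fn; rewrite -(below (f i)) // ffi.
have [lt_dg | le_gd] := ltnP d (g i); last first.
  by have [_] := inv_f _ lt_gn; rewrite (below (g i)) // ggi.
have := fixed_above_d incr_f inv_f lt_di lt_in lt_df.
by have := fixed_above_d incr_g inv_g lt_di lt_in lt_dg; lia.
Qed.

End OneDescent.

(** * Quadratic upper bound for one descent *)

Lemma increasing_off_descent n (s : 'S_n) (d : 'I_n) :
  descents s = [set d] -> increasing_off_d n d (nat_of_perm s).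
Proof.
move=> des_s i lt_in ne_id; rewrite ltn_neqAle; apply/andP; split.
  apply/eqP => /nat_of_perm_inj eq_i.
  by have := eq_i (ltnW lt_in) lt_in; lia.
rewrite leqNgt; apply/negP => lt_s.
have: Ordinal (ltnW lt_in) \in descents s by rewrite mem_descents /= lt_in.
by rewrite des_s inE -val_eqE /= (negPf ne_id).
Qed.

Lemma inv_des1_le n : 0 < n -> inv_des n 1 <= n ^ 2.
Proof.
move=> n_gt0; pose x0 := Ordinal n_gt0.
pose des (s : 'S_n) := odflt x0 [pick i in descents s].
have desE s : #|descents s| == 1 -> descents s = [set des s].
  move/cards1P=> [d eq_d]; rewrite eq_d /des.
  case: pickP => [i | /(_ d)]; last by rewrite eq_d inE eqxx.
  by rewrite eq_d inE => /eqP->.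
(* The descent and the value there form one of [n ^ 2] pairs; rigidity makes this map injective. *)
rewrite /inv_des -(card_in_imset (f := fun s => (des s, s (des s)))).
  by rewrite (leq_trans (max_card _)) // card_prod card_ord mulnn.
move=> s t; rewrite !inE.
move=> /andP[inv_s /desE des_s] /andP[inv_t /desE des_t] [eq_des eq_val].
rewrite -eq_des in des_t eq_val.
have invol (u : 'S_n) :
    [forall i, u (u i) == i] -> involution_below n (nat_of_perm u).
  move=> inv_u i lt_in; split; first exact: nat_of_perm_lt.
  by apply: nat_of_perm_involutive; rewrite ?inE.
apply/permP => i; apply: ord_inj; rewrite -!nat_of_permE.
apply: (one_descent_involution_eq (ltn_ord (des s)) _ _ _ _ _ (ltn_ord i)).
- exact: increasing_off_descent.
- exact: invol.
- exact: increasing_off_descent.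
- exact: invol.
- by rewrite !nat_of_permE eq_val.
Qed.

Lemma inv_des0_gt0 n : 0 < inv_des n 0.
Proof.
apply/card_gt0P; exists 1%g; rewrite !inE; apply/andP; split.
  by apply/forallP => i; rewrite !perm1.
rewrite cards_eq0; apply/eqP/setP => i; rewrite !inE.
apply/negbTE/existsP => -[j /andP[/eqP ij]].
by rewrite !perm1 [X in X < _]ij ltnNge leqnSn.
Qed.

(** * The block-swapping involutions *)

Section BlockSwap.

(* Sizes of [P11], [P12], [P13], [P22], [P23] in this order; [P33] is what
   remains. *)
Variables a x y b z : nat.

Definition row1_end := a + x + y.
Definition row2_end := row1_end + x + b + z.

(** The branches run through [P11], [P12], .., [P32] in order, the last one fixing [P33] and beyond;
    each shift is the distance between the starts of [Pij] and [Pji]. *)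
Definition block_swap (p : nat) : nat :=
  if p < a then p else
  if p < a + x then p + (x + y) else
  if p < row1_end then p + (x + y + b + z) else
  if p < row1_end + x then p - (x + y) else
  if p < row1_end + x + b then p else
  if p < row2_end then p + (y + z) else
  if p < row2_end + y then p - (x + y + b + z) else
  if p < row2_end + y + z then p - (y + z) else p.

Lemma block_swapK : involutive block_swap.
Proof.
move=> p; rewrite [block_swap p]/block_swap /row2_end /row1_end.
by do 8?[case: ifP => ?]; rewrite /block_swap /row2_end /row1_end;
   do 8?[case: ifP => ?]; lia.
Qed.

Lemma block_swap_lt n p : row2_end + y + z <= n -> p < n -> block_swap p < n.
Proof.
by rewrite /block_swap /row2_end /row1_end; do 8?[case: ifP => ?]; lia.
Qed.

Hypotheses (x_gt0 : 0 < x) (y_gt0 : 0 < y) (z_gt0 : 0 < z).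

Lemma block_swap_descent p :
  (block_swap p.+1 < block_swap p) = (p.+1 == row1_end) || (p.+1 == row2_end).
Proof.
rewrite [block_swap p]/block_swap /row2_end /row1_end.
by do 8?[case: ifP => ?]; rewrite /block_swap /row2_end /row1_end;
   do 8?[case: ifP => ?]; lia.
Qed.

Lemma block_swap_row1_end : block_swap row1_end = a.
Proof.
by rewrite /block_swap /row2_end /row1_end; do 8?[case: ifP => ?]; lia.
Qed.

Lemma block_swap_row1_last : block_swap row1_end.-1 = (row2_end + y).-1.
Proof.
by rewrite /block_swap /row2_end /row1_end; do 8?[case: ifP => ?]; lia.
Qed.

Lemma block_swap_row2_last : block_swap row2_end.-1 = (row2_end + y + z).-1.
Proof.
by rewrite /block_swap /row2_end /row1_end; do 8?[case: ifP => ?]; lia.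
Qed.

Lemma row_ends_lt : 0 < row1_end < row2_end.
Proof. by rewrite /row2_end /row1_end; lia. Qed.

End BlockSwap.

(** The descents reveal both row ends. The values at the first row end and just before each row end
    then give [a], [y] and [z]; subtraction gives [x] and [b]. *)
Lemma block_swap_inj n a x y b z a' x' y' b' z' :
    0 < x -> 0 < y -> 0 < z -> 0 < x' -> 0 < y' -> 0 < z' ->
    row2_end a x y b z + y + z <= n ->
    row2_end a' x' y' b' z' + y' + z' <= n ->
    (forall p, p < n -> block_swap a x y b z p = block_swap a' x' y' b' z' p) ->
  [/\ a = a', x = x', y = y', b = b' & z = z'].
Proof.
move=> x0 y0 z0 x0' y0' z0' le_n le_n' eq_f.
have des p : 0 < p < n ->
    (p == row1_end a x y) || (p == row2_end a x y b z)
    = (p == row1_end a' x' y') || (p == row2_end a' x' y' b' z').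
  case: p => // p lt_pn; rewrite -!block_swap_descent //.
  by rewrite !eq_f // ltnW.
have r := row_ends_lt a b x0 y0 z0; have r' := row_ends_lt a' b' x0' y0' z0'.
have e1 := block_swap_row1_end a b x0 y0 z0.
have e2 := block_swap_row1_last a b x0 y0 z0.
have e3 := block_swap_row2_last a b x0 y0 z0.
have e1' := block_swap_row1_end a' b' x0' y0' z0'.
have e2' := block_swap_row1_last a' b' x0' y0' z0'.
have e3' := block_swap_row2_last a' b' x0' y0' z0'.
have [eq1 eq2] : row1_end a x y = row1_end a' x' y'
              /\ row2_end a x y b z = row2_end a' x' y' b' z'.
  have := des (row1_end a x y); have := des (row2_end a x y b z).
  rewrite !eqxx orbT => /(_ _)/esym mem2 /(_ _)/esym mem1.
  have {}mem1 := mem1 ltac:(lia); have {}mem2 := mem2 ltac:(lia).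
  by clear - mem1 mem2 r r'; lia.
rewrite eq_f in e1; last by lia.
rewrite eq_f in e2; last by lia.
rewrite eq_f in e3; last by lia.
rewrite eq1 eq2 in e1 e2 e3.
have ea : a = a' by lia.
have ey : y = y' by lia.
have ez : z = z' by lia.
by move: eq1 eq2; rewrite /row2_end /row1_end; split; lia.
Qed.

(** * Fifth-power lower bound for two descents *)

Section PermOfInvolution.

Variables (n : nat) (f : nat -> nat).
Hypotheses (fK : involutive f) (f_lt : forall p, p < n -> f p < n).

Definition ord_fun (i : 'I_n) : 'I_n := Ordinal (f_lt (ltn_ord i)).

Lemma ord_funK : involutive ord_fun.
Proof. by move=> i; apply: val_inj; rewrite /= fK. Qed.

Definition perm_of_involution : 'S_n := perm (can_inj ord_funK).

Lemma perm_of_involution_mem : perm_of_involution \in involutions n.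
Proof. by rewrite inE; apply/forallP => i; rewrite !permE ord_funK. Qed.

Lemma nat_of_perm_of_involution p :
  p < n -> nat_of_perm perm_of_involution p = f p.
Proof.
by move=> lt_pn; rewrite (nat_of_permE _ (Ordinal lt_pn)) permE.
Qed.

End PermOfInvolution.

(** Each free size takes [m] values. The diagonal sizes [a], [b] count once in the total length and
    the off-diagonal ones twice, so [2 + 3 * 2 = 8] times [m] positions suffice. *)
Lemma inv_des2_ge m : m ^ 5 <= inv_des (8 * m) 2.
Proof.
set n := 8 * m; set T := ('I_m * 'I_m * 'I_m * 'I_m * 'I_m)%type.
(* The successors make the off-diagonal intervals nonempty. *)
pose swap (t : T) :=
  let: (a, x, y, b, z) := t in block_swap a x.+1 y.+1 b z.+1.
have swapK t : involutive (swap t).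
  by case: t => [[[[a x] y] b] z]; apply: block_swapK.
have fits (a x y b z : 'I_m) :
    row2_end a x.+1 y.+1 b z.+1 + y.+1 + z.+1 <= n.
  have := (ltn_ord a, ltn_ord x, ltn_ord y, ltn_ord b, ltn_ord z).
  by rewrite /row2_end /row1_end /n => -[[[[]]]]; lia.
have swap_lt t p : p < n -> swap t p < n.
  by case: t => [[[[a x] y] b] z]; apply: block_swap_lt.
pose s t : 'S_n := perm_of_involution (swapK t) (@swap_lt t).
have s_inj : injective s.
  move=> t t' eq_s; have: forall p, p < n -> swap t p = swap t' p.
    move=> p lt_pn; rewrite -(nat_of_perm_of_involution (swapK t) (@swap_lt t)) //.
    rewrite -(nat_of_perm_of_involution (swapK t') (@swap_lt t')) //.
    by rewrite -/(s t) eq_s.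
  move: t t' {eq_s} => [[[[a x] y] b] z] [[[[a' x'] y'] b'] z'].
  case/block_swap_inj=> // /val_inj -> [/val_inj ->] [/val_inj ->].
  by move=> /val_inj -> [/val_inj ->].
have -> : m ^ 5 = #|s @: [set: T]|.
  by rewrite card_imset // cardsT !card_prod !card_ord !expnSr mul1n.
apply/subset_leq_card/subsetP => _ /imsetP[t _ ->].
rewrite inE perm_of_involution_mem /=.
case: t => [[[[a x] y] b] z].
set r1 := row1_end a x.+1 y.+1; set r2 := row2_end a x.+1 y.+1 b z.+1.
have r12 : 0 < r1 < r2 by apply: row_ends_lt.
have r2n := fits a x y b z.
(* A descent is indexed by the last position of a row, one before the row end. *)
have d1 : r1.-1 < n by lia.
have d2 : r2.-1 < n by lia.
suff -> : descents (s (a, x, y, b, z)) = [set Ordinal d1; Ordinal d2].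
  by rewrite cards2 -val_eqE /=; have -> : r1.-1 != r2.-1 by lia.
apply/setP => i; rewrite mem_descents !inE -!val_eqE /=.
case: ltnP => [lt_in | le_ni] /=; last by lia.
rewrite !nat_of_perm_of_involution ?(ltnW lt_in) // block_swap_descent //.
by rewrite -/r1 -/r2; lia.
Qed.

(** * Failure of log-concavity *)

Lemma coef_inv_des_poly n k :
  k < n -> ((inv_des_poly n)`_k)%R = ((inv_des n k)%:R)%R.
Proof.
move=> lt_kn; rewrite /inv_des_poly -(poly_def n (fun k => (inv_des n k)%:R)%R).
by rewrite coef_poly lt_kn.
Qed.

Lemma inv_des_not_log_concave m :
  8 ^ 4 < m -> inv_des (8 * m) 1 ^ 2 < inv_des (8 * m) 0 * inv_des (8 * m) 2.
Proof.
move=> lt_m; have m_gt0 : 0 < m := leq_trans (ltn0Sn _) lt_m.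
have n_gt0 : 0 < 8 * m by rewrite muln_gt0.
(* The quadratic bound squared is [(8 * m) ^ 4], which [m ^ 5] exceeds once [8 ^ 4 < m]. *)
have le1 : inv_des (8 * m) 1 ^ 2 <= 8 ^ 4 * m ^ 4.
  by rewrite -expnMn -[4]/(2 * 2) expnM leq_exp2r // inv_des1_le.
apply: (leq_ltn_trans le1).
apply: (@leq_trans (m ^ 5)); first by rewrite [m ^ 5]expnS ltn_pmul2r // expn_gt0 m_gt0.
by rewrite (leq_trans (inv_des2_ge m)) // leq_pmull // inv_des0_gt0.
Qed.

Theorem theorem7 :
  exists n : nat,
    [/\ 0 < n,
        ~ log_concave (fun k => ((inv_des_poly n)`_k)%R) &
        exists k : nat,
          0 < k /\ inv_des n k ^ 2 < inv_des n k.-1 * inv_des n k.+1].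
Proof.
(* Destructing the existential keeps [m] a variable instead of a large unary numeral. *)
have [m lt_m] : exists m, 8 ^ 4 < m by exists (8 ^ 4).+1.
have m_gt0 : 0 < m := leq_trans (ltn0Sn _) lt_m.
have ineq := inv_des_not_log_concave lt_m.
exists (8 * m); split; first by rewrite muln_gt0.
- move/(_ 1 isT); rewrite !coef_inv_des_poly; [|lia..].
  by rewrite -GRing.natrX -GRing.natrM Num.Theory.ler_nat leqNgt ineq.
- by exists 1.
Qed.
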